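(* Let $\mathcal{L}\subseteq\mathbf{Z}^n$ be a lattice of dimension $m$, let $B\in\mathbf{Z}^{n\times m}$ be a matrix whose columns form a basis of $\mathcal{L}$, and let $b_1,\ldots,b_n$ be the rows of $B$. Then $$\mathrm{rad}(V_{\mathcal{L}})=\bigcap_{\sigma}\langle x_i : i\in\sigma\rangle,$$ where the intersection is over all subsets $\sigma\subseteq\{1,\ldots,n\}$ of size $m$ such that $\{b_i: i\in\sigma\}$ is linearly independent.
   Context: $S=k[x_1,\ldots,x_n]$, $x^u=\prod_i x_i^{u_i}$. The dimension of a lattice is its rank. For $u\in\mathbf{N}^n$ the fiber is $P_u=\mathrm{conv}\{v\in\mathbf{N}^n: u-v\in\mathcal{L}\}$; the vertex ideal $V_{\mathcal{L}}$ is the monomial ideal spanned by monomials $x^v$ with $v$ not a vertex of $P_v$. *)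

(* Defs.v *)
From HB Require Import structures.
From mathcomp Require Import all_boot all_order all_algebra.
From mathcomp Require Import classical_sets reals.
From mathcomp Require Import mpoly.

Set Implicit Arguments.
Unset Strict Implicit.
Unset Printing Implicit Defensive.

Import Order.TTheory GRing.Theory Num.Theory.

Local Open Scope classical_set_scope.
Local Open Scope ring_scope.

Definition lattice_basis n m (L : zmodClosed 'cV[int]_n) (B : 'M[int]_(n, m)) :=
  (forall v : 'cV[int]_n, v \in L <-> exists a : 'cV[int]_m, v = B *m a) /\
  (forall a : 'cV[int]_m, B *m a = 0 -> a = 0).

Definition lattice_dim n (L : zmodClosed 'cV[int]_n) (m : nat) :=
  exists B : 'M[int]_(n, m), lattice_basis L B.

Definition conv_hull (R : realType) n (X : set 'cV[R]_n) : set 'cV[R]_n :=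
  [set x | exists (r : nat) (t : 'I_r -> R) (p : 'I_r -> 'cV[R]_n),
    [/\ forall i, 0 <= t i, \sum_i t i = 1, forall i, X (p i)
      & x = \sum_i t i *: p i]].

(* A vertex is a zero-dimensional face: the unique point of [P] at which some
   linear functional attains its maximum over [P]. *)
Definition is_vertex (R : realType) n (P : set 'cV[R]_n) (x : 'cV[R]_n) :=
  P x /\ exists c : 'rV[R]_n,
    forall y, P y -> y <> x -> (c *m y) 0 0 < (c *m x) 0 0.

Definition zpoint n (u : 'X_{1..n}) : 'cV[int]_n := \col_i (u i)%:Z.

Definition rpoint (R : realType) n (u : 'X_{1..n}) : 'cV[R]_n := \col_i (u i)%:R.

Definition fiber (R : realType) n (L : zmodClosed 'cV[int]_n) (u : 'X_{1..n}) :
    set 'cV[R]_n :=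
  conv_hull [set rpoint R v | v in [set v : 'X_{1..n} | zpoint u - zpoint v \in L]].
Arguments fiber R {n} L u.

Definition ideal_gen (S : comNzRingType) (G : set S) : set S :=
  [set f | exists (r : nat) (a g : 'I_r -> S),
    (forall i, G (g i)) /\ f = \sum_i a i * g i].

Definition radical (S : comNzRingType) (I : set S) : set S :=
  [set f | exists e : nat, I (f ^+ e)].

Definition vertex_ideal (R : realType) (k : fieldType) n
    (L : zmodClosed 'cV[int]_n) : set {mpoly k[n]} :=
  ideal_gen [set 'X_[v] |
    v in [set v : 'X_{1..n} | ~ is_vertex (fiber R L v) (rpoint R v)]].
Arguments vertex_ideal R k {n} L.

(* The set of non-vertices is closed under adding exponent vectors, so the ideal
   generated by the monomials above coincides with their k-linear span. *)
Lemma nonvertexD (R : realType) n (L : zmodClosed 'cV[int]_n) (v w : 'X_{1..n}) :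
  ~ is_vertex (fiber R L v) (rpoint R v) ->
  ~ is_vertex (fiber R L (v + w)%MM) (rpoint R (v + w)%MM).
Proof.
have rD a : rpoint R (a + w)%MM = rpoint R a + rpoint R w.
  by apply/colP => i; rewrite !mxE mnmDE natrD.
move=> nv [_ [c cP]]; apply: nv; split.
  exists 1, (fun=> 1), (fun=> rpoint R v); split=> //.
  - by rewrite big_ord1.
  - by move=> _; exists v => //=; rewrite subrr rpred0.
  - by rewrite big_ord1 scale1r.
exists c => y [r [t [p [t0 t1 pX yE]]]] yv.
have /cP : fiber R L (v + w)%MM (y + rpoint R w).
  exists r, t, (fun i => p i + rpoint R w); split=> //.
    move=> i; have [u /= uL <-] := pX i; exists (u + w)%MM; last by rewrite rD.
    rewrite /=; suff -> : zpoint (v + w)%MM - zpoint (u + w)%MM =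
      zpoint v - zpoint u by [].
    by apply/colP => j; rewrite !mxE !mnmDE !PoszD opprD addrACA subrr addr0.
  under eq_bigr do rewrite scalerDr.
  by rewrite big_split /= -yE -scaler_suml t1 scale1r.
rewrite rD => /(_ _) h; have {}h := h (fun e => yv (addIr _ e)).
by move: h; rewrite !mulmxDr ![in X in X -> _]mxE ltrD2r !mxE.
Qed.

Lemma vertex_ideal_span (R : realType) (k : fieldType) n
    (L : zmodClosed 'cV[int]_n) (f : {mpoly k[n]}) :
  vertex_ideal R k L f <->
  (forall v, v \in msupp f -> ~ is_vertex (fiber R L v) (rpoint R v)).
Proof.
split=> [[r [a [g [gG ->]]]] v|fV].
  move=> /msupp_sum_le /flattenP[_ /mapP[i _ ->]].
  have [u nu <-] := gG i; rewrite (perm_mem (msuppMX _ _)) => /mapP[w _ ->].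
  exact: nonvertexD.
exists (size (msupp f)), (fun i => (f@_(nth 0%MM (msupp f) i))%:MP),
  (fun i => 'X_[nth 0%MM (msupp f) i]); split=> [i|].
  by exists (nth 0%MM (msupp f) i) => //=; apply: fV; rewrite mem_nth.
rewrite [LHS]mpolyE (big_nth 0%MM) big_mkord.
by apply: eq_bigr => i _; rewrite mul_mpolyC.
Qed.

(* Main.v *)
(* The monomial [x^v] fails to lie in the radical exactly when [v *+ e] is a
   vertex of its fiber for every [e].  If the rows indexed by [s] form a basis
   and [v] vanishes on [s], then [- \sum_(i in s) x_i] is maximal on the fiber
   of [v] at [v] only: on that fiber it is nonpositive, and it vanishes only at
   [v] because a lattice vector that is zero on [s] is zero.  If instead the
   rows outside the support of [v] have rank less than [m], some nonzero lattice
   vector [l] is supported in the support of [v], and [v *+ e] is the midpoint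
   of [v *+ e + l] and [v *+ e - l] in its fiber once [e] is large. *)
Require Import Defs.
From HB Require Import structures.
From mathcomp Require Import all_boot all_order all_algebra.
From mathcomp Require Import classical_sets reals.
From mathcomp Require Import mpoly.

Set Implicit Arguments.
Unset Strict Implicit.
Unset Printing Implicit Defensive.

Import Order.TTheory GRing.Theory Num.Theory.

Local Open Scope classical_set_scope.
Local Open Scope ring_scope.

(** * Ideals given by generators, and their radicals *)

Lemma ideal_gen0 (S : comNzRingType) (G : set S) : ideal_gen G 0.
Proof.
by exists 0, (fun=> 0), (fun=> 0); split; [case | rewrite big_ord0].
Qed.

Lemma ideal_gen_mem (S : comNzRingType) (G : set S) g : G g -> ideal_gen G g.
Proof. by exists 1, (fun=> 1), (fun=> g); rewrite big_ord1 mul1r. Qed.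

Lemma ideal_genD (S : comNzRingType) (G : set S) f g :
  ideal_gen G f -> ideal_gen G g -> ideal_gen G (f + g).
Proof.
move=> [r [a [x [xG ->]]]] [q [b [y [yG ->]]]].
pose glue T (u : 'I_r -> T) (w : 'I_q -> T) (i : 'I_(r + q)) :=
  match split i with inl j => u j | inr j => w j end.
have glueL T u w j : glue T u w (lshift q j) = u j.
  by rewrite /glue (unsplitK (inl j)).
have glueR T u w j : glue T u w (rshift r j) = w j.
  by rewrite /glue (unsplitK (inr j)).
exists (r + q), (glue _ a b), (glue _ x y); split=> [i|].
  by rewrite /glue; case: split.
by rewrite big_split_ord /=; congr (_ + _); apply: eq_bigr => j _;
  rewrite ?glueL ?glueR.
Qed.

Lemma ideal_genMl (S : comNzRingType) (G : set S) f g :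
  ideal_gen G g -> ideal_gen G (f * g).
Proof.
move=> [r [a [x [xG ->]]]]; exists r, (fun i => f * a i), x; split=> //.
by rewrite mulr_sumr; apply: eq_bigr => i _; rewrite mulrA.
Qed.

Lemma ideal_gen_sum (S : comNzRingType) (G : set S) (I : eqType) (r : seq I)
    (F : I -> S) :
  (forall i, i \in r -> ideal_gen G (F i)) -> ideal_gen G (\sum_(i <- r) F i).
Proof.
move=> FG; rewrite big_seq.
by elim/big_ind: _ => //; [exact: ideal_gen0 | exact: ideal_genD].
Qed.

(** In each term of the binomial expansion of [(f + g) ^+ (p + q)], either the exponent of [g] is at
    least [q] or that of [f] is at least [p]. *)
Lemma radicalD (S : comNzRingType) (G : set S) f g :
  radical (ideal_gen G) f -> radical (ideal_gen G) g ->
  radical (ideal_gen G) (f + g).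
Proof.
move=> [p fG] [q gG]; exists (p + q)%N; rewrite exprDn.
apply: ideal_gen_sum => i _; rewrite -mulr_natl; apply: ideal_genMl.
have [le_qi|lt_iq] := leqP q i.
  have -> : g ^+ i = g ^+ (i - q) * g ^+ q by rewrite -exprD subnK.
  by rewrite mulrA; apply: ideal_genMl.
rewrite mulrC -addnBA ?(ltnW lt_iq) //.
by rewrite [f ^+ _]exprD [f ^+ p * _]mulrC mulrA; apply: ideal_genMl.
Qed.

Lemma radicalMl (S : comNzRingType) (G : set S) f g :
  radical (ideal_gen G) g -> radical (ideal_gen G) (f * g).
Proof. by case=> e gG; exists e; rewrite exprMn; apply: ideal_genMl. Qed.

Lemma radical_sum (S : comNzRingType) (G : set S) (I : eqType) (r : seq I)
    (F : I -> S) :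
  (forall i, i \in r -> radical (ideal_gen G) (F i)) ->
  radical (ideal_gen G) (\sum_(i <- r) F i).
Proof.
move=> FG; rewrite big_seq; elim/big_ind: _ => //; last exact: radicalD.
by exists 1; apply: ideal_gen0.
Qed.

(** * Ideals generated by variables *)

Definition restrict_vars (k : fieldType) n (s : {set 'I_n}) :
    n.-tuple {mpoly k[n]} :=
  [tuple if i \in s then 0 else 'X_i | i < n].

Lemma restrict_varsX (k : fieldType) n (s : {set 'I_n}) (v : 'X_{1..n}) :
  'X_[v] \mPo restrict_vars k s =
  if [forall i in s, v i == 0%N] then 'X_[v] else 0.
Proof.
rewrite comp_mpolyX; case: ifP => [/forall_inP v0|/negbT].
  rewrite (mpolyXE_id k v); apply: eq_bigr => i _; rewrite tnth_mktuple.
  by case: ifP => // /v0/eqP->; rewrite !expr0.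
rewrite negb_forall_in => /exists_inP[i si vi]; rewrite (bigD1 i) //=.
by rewrite tnth_mktuple si expr0n (negPf vi) mul0r.
Qed.

Lemma mcoeff_restrict_vars (k : fieldType) n (s : {set 'I_n})
    (f : {mpoly k[n]}) (v : 'X_{1..n}) :
  (f \mPo restrict_vars k s)@_v =
  if [forall i in s, v i == 0%N] then f@_v else 0.
Proof.
rewrite comp_mpolyEX [in RHS](mpolyE f) !linear_sum /=.
have E (u : 'X_{1..n}) : (f@_u *: ('X_[u] \mPo restrict_vars k s))@_v =
    if [forall i in s, v i == 0%N] then (f@_u *: 'X_[u])@_v else 0.
  rewrite restrict_varsX !mcoeffZ.
  (* If the two conditions disagree, then [u] and [v] differ and ['X_[u]] has coefficient 0 at
     [v]. *)
  case: ifP => uE; case: ifP => vE //; rewrite ?mcoeff0 ?mulr0 //.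
    by rewrite mcoeffX; case: eqP uE vE => [->->|_]; rewrite ?mulr0.
  by rewrite mcoeffX; case: eqP uE vE => [->->|_]; rewrite ?mulr0.
rewrite (eq_bigr _ (fun u _ => E u)).
by case: ifP => // _; rewrite big1.
Qed.

Lemma restrict_vars_eq0P (k : fieldType) n (s : {set 'I_n})
    (f : {mpoly k[n]}) :
  f \mPo restrict_vars k s = 0 <->
  (forall v, v \in msupp f -> exists2 i, i \in s & v i != 0%N).
Proof.
split=> [f0 v|supp_s].
  rewrite mcoeff_msupp => fv; apply/exists_inP.
  rewrite -negb_forall_in; apply: contra fv => v0.
  by have := mcoeff_restrict_vars s f v; rewrite f0 v0 mcoeff0 => <-.
apply/mpolyP => v; rewrite mcoeff_restrict_vars mcoeff0; case: ifP => //.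
move=> /forall_inP v0; apply: memN_msupp_eq0; apply/negP => /supp_s[i si].
by rewrite v0.
Qed.

Lemma var_idealP (k : fieldType) n (s : {set 'I_n}) (f : {mpoly k[n]}) :
  ideal_gen [set ('X_i : {mpoly k[n]}) | i in [set i : 'I_n | i \in s]] f <->
  f \mPo restrict_vars k s = 0.
Proof.
split=> [[r [a [x [xs ->]]]]|/restrict_vars_eq0P supp_s].
  rewrite rmorph_sum big1 // => i _; rewrite rmorphM /=.
  have [j /= sj <-] := xs i.
  by rewrite comp_mpolyXU (nth_map j) ?size_enum_ord // nth_ord_enum sj mulr0.
rewrite (mpolyE f); apply: ideal_gen_sum => v /supp_s[i si vi].
have -> : f@_v *: 'X_[v] = (f@_v *: 'X_[v - U_(i)]) * 'X_i :> {mpoly k[n]}.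
  by rewrite -scalerAl -mpolyXD submK // lep1mP.
by apply/ideal_genMl/ideal_gen_mem; exists i.
Qed.

(** The ideal is the kernel of a ring morphism into an integral domain, where a power vanishes only
    if its base does. *)
Lemma var_ideal_radical (k : fieldType) n (s : {set 'I_n}) (f : {mpoly k[n]}) :
  radical (ideal_gen
    [set ('X_i : {mpoly k[n]}) | i in [set i : 'I_n | i \in s]]) f ->
  ideal_gen [set ('X_i : {mpoly k[n]}) | i in [set i : 'I_n | i \in s]] f.
Proof.
case=> e /var_idealP; rewrite rmorphXn => /eqP.
rewrite expf_eq0 => /andP[_ /eqP f0].
exact/var_idealP.
Qed.

(** * Independent rows and kernel vectors *)

Lemma free_rows_inj (F : fieldType) n m (A : 'M[F]_(n, m)) (s : {set 'I_n})
    (a : 'cV[F]_m) :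
  #|s| = m -> free [seq row i A | i in s] ->
  (forall i, i \in s -> (A *m a) i 0 = 0) -> a = 0.
Proof.
move=> sm frA Aa0; pose X := [tuple of [seq row i A | i in s]].
(* The [m] free rows span the whole space, so every row vector kills [a], in particular the rows of
   the identity matrix. *)
have spX : <<X>>%VS = fullv.
  apply/eqP; rewrite eqEdim subvf dimvf /dim /= mul1n.
  by move: frA; rewrite /free => /eqP ->; rewrite size_image sm.
have all0 (u : 'rV[F]_m) : u *m a = 0.
  have /coord_span -> : u \in <<X>>%VS by rewrite spX memvf.
  rewrite mulmx_suml big1 // => i _; rewrite -scalemxAl.
  have /fintype.imageP[j sj ->] : X`_i \in [seq row i A | i in s].
    by apply: mem_nth; rewrite size_tuple.
  rewrite -row_mul [row _ _]mx11_scalar !mxE.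
  have := Aa0 j sj; rewrite !mxE => ->.
  by rewrite raddf0 scaler0.
by rewrite -(mul1mx a); apply/row_matrixP => i; rewrite row_mul all0 row0.
Qed.

Lemma row_full_free_rows (F : fieldType) n m (A : 'M[F]_(n, m))
    (t : {set 'I_n}) :
  row_full (\matrix_i (if i \in t then row i A else 0)) ->
  exists s : {set 'I_n},
    [/\ s \subset t, #|s| = m & free [seq row i A | i in s]].
Proof.
set At := \matrix_i _ => fullA; set f := fullrankfun fullA.
have f_inj : injective f := @fullrankfun_inj _ _ _ _ fullA.
have frA := fullrowsub_free fullA.
(* An index outside [t] selects a zero row, whose product with a right inverse [D] cannot be a row
   of the identity. *)
have ft j : f j \in t.
  apply/negPn/negP => ftj; move/row_freeP: frA => [D] /row_matrixP/(_ j).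
  rewrite row_mul; have -> : row j (rowsub f At) = 0.
    by apply/rowP => l; rewrite !mxE (negPf ftj) mxE.
  rewrite mul0mx => /rowP/(_ j); rewrite !mxE eqxx => /eqP.
  by rewrite eq_sym oner_eq0.
exists (f @: 'I_m); split.
- by apply/fintype.subsetP => _ /imsetP[j _ ->].
- by rewrite card_imset // card_ord.
set s := f @: 'I_m.
apply/(@freeP _ _ _ [tuple of [seq row i A | i in s]]) => c c0.
have fs j : f j \in s by apply: imset_f.
(* The coefficients [c] follow the enumeration of [s]; reindexed along [f], they form a row vector
   in the left kernel of [rowsub f At]. *)
pose d : 'rV[F]_m := \row_j c (enum_rank_in (fs j) (f j)).
have dA : d *m rowsub f At = 0.
  rewrite mulmx_sum_row -[RHS]c0.
  rewrite [RHS](reindex (fun j => enum_rank_in (fs j) (f j))) /=; last first.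
    have inv (i : 'I_#|s|) : exists j, f j == enum_val i.
      by have /imsetP[j _ ->] : enum_val i \in s := enum_valP i; exists j.
    exists (fun i => xchoose (inv i)) => [j _|i _].
      by apply: f_inj; rewrite (eqP (xchooseP (inv _))) enum_rankK_in.
    apply: enum_val_inj; rewrite enum_rankK_in //.
    exact: eqP (xchooseP (inv i)).
  apply: eq_bigr => j _; rewrite mxE; congr (_ *: _).
  rewrite nth_image enum_rankK_in //.
  by apply/rowP => l; rewrite !mxE ft mxE.
have {dA}d0 : d = 0 by apply: (row_free_inj frA); rewrite dA mul0mx.
move=> i; have /imsetP[j _ ij] : enum_val i \in s := enum_valP i.
have := congr1 (fun e : 'rV_m => e 0 j) d0; rewrite !mxE.
suff -> : enum_rank_in (fs j) (f j) = i by [].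
by apply: enum_val_inj; rewrite enum_rankK_in.
Qed.

(** Rank arguments produce rational kernel vectors; this scales them to integral ones, which yield
    lattice vectors. *)
Lemma clear_denominators m (a : 'cV[rat]_m) :
  exists (d : int) (z : 'cV[int]_m),
    d != 0 /\ map_mx (intr : int -> rat) z = d%:~R *: a.
Proof.
exists (\prod_j denq (a j 0)),
  (\col_j (numq (a j 0) * \prod_(l | l != j) denq (a l 0))); split.
  by apply/prodf_neq0 => j _; exact: denq_neq0.
apply/colP => j; rewrite !mxE [in RHS](bigD1 j) //= !intrM numqE.
by rewrite [RHS]mulrC mulrA.
Qed.

(** Replace the rows outside [t] by zero. If the rank is still [m], independent rows can be
    selected; otherwise there is a nonzero rational kernel vector, made integral by scaling. *)
Lemma kernel_or_free_rows n m (B : 'M[int]_(n, m)) (t : {set 'I_n}) :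
  (exists s : {set 'I_n}, [/\ s \subset t, #|s| = m &
     free [seq row i (map_mx (intr : int -> rat) B) | i in s]]) \/
  (exists2 a : 'cV[int]_m, a != 0 & forall i, i \in t -> (B *m a) i 0 = 0).
Proof.
set A := map_mx _ B.
have [/row_full_free_rows|] :=
  boolP (row_full (\matrix_i (if i \in t then row i A else 0))).
  by left.
set At := \matrix_i _ => nfull; right.
have : kermx At^T != 0.
  by rewrite kermx_eq0 /row_free mxrank_tr.
move=> /rowV0Pn[x /sub_kermxP xA x0].
have [d [z [d0 zE]]] := clear_denominators x^T.
exists z.
  apply: contra x0 => /eqP z0; move: zE; rewrite z0 map_mx0 => /esym/eqP.
  by rewrite scaler_eq0 intr_eq0 (negPf d0) /= trmx_eq0.
move=> i it; apply/eqP; rewrite -(intr_eq0 rat).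
have -> : ((B *m z) i 0)%:~R = (A *m map_mx intr z) i 0 :> rat.
  by rewrite -map_mxM [in RHS]mxE.
have : (At *m x^T) i 0 = 0.
  by rewrite -[At]trmxK -trmx_mul xA !mxE.
rewrite zE -scalemxAr [in X in _ -> X]mxE.
suff -> : (A *m x^T) i 0 = (At *m x^T) i 0 by move=> ->; rewrite mulr0.
by rewrite !mxE; apply: eq_bigr => j _; rewrite !mxE it !mxE.
Qed.

(** * Vertices of fibers *)

Lemma is_vertex_conv_hull (R : realType) n (X : set 'cV[R]_n) (x : 'cV[R]_n)
    (c : 'rV[R]_n) :
  X x -> (forall y, X y -> y <> x -> (c *m y) 0 0 < (c *m x) 0 0) ->
  is_vertex (conv_hull X) x.
Proof.
move=> Xx cX; split.
  by exists 1, (fun=> 1), (fun=> x); split; rewrite ?big_ord1 ?scale1r.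
exists c => y [r [t [p [t0 t1 pX yE]]]] yx.
have le_p i : (c *m p i) 0 0 <= (c *m x) 0 0.
  by have [->//|/eqP pix] := eqVneq (p i) x; apply/ltW/cX.
(* The gap at [y] is the weighted sum of the nonnegative gaps at the [p i]. If it were 0, every
   [p i] other than [x] would have weight 0, forcing [y = x]. *)
have gap : (c *m x) 0 0 - (c *m y) 0 0 =
    \sum_i t i * ((c *m x) 0 0 - (c *m p i) 0 0).
  rewrite yE mulmx_sumr summxE -[X in X - _]mul1r -t1 mulr_suml -sumrB.
  by apply: eq_bigr => i _; rewrite -scalemxAr [X in _ - X]mxE mulrBr.
have gap_ge0 i : 0 <= t i * ((c *m x) 0 0 - (c *m p i) 0 0).
  by rewrite mulr_ge0 // subr_ge0.
rewrite -subr_gt0 gap lt_def sumr_ge0 ?andbT //.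
apply/negP => /eqP/psumr_eq0P/(_ _ isT) tp0; apply: yx.
rewrite yE -[RHS]scale1r -t1 scaler_suml; apply: eq_bigr => i _.
have [->//|/eqP pix] := eqVneq (p i) x.
have := tp0 (fun i _ => gap_ge0 i) i; move/eqP.
rewrite mulf_eq0 subr_eq0 [X in _ || X]gt_eqF; last exact: cX.
by rewrite orbF => /eqP ->; rewrite !scale0r.
Qed.

Lemma rpointB (R : realType) n (v u : 'X_{1..n}) :
  rpoint R v - rpoint R u = map_mx intr (zpoint v - zpoint u).
Proof. by apply/colP => i; rewrite !mxE rmorphB. Qed.

Lemma is_vertex_fiber (R : realType) n (L : zmodClosed 'cV[int]_n)
    (s : {set 'I_n}) (v : 'X_{1..n}) :
  (forall l, l \in L -> (forall i, i \in s -> l i 0 = 0) -> l = 0) ->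
  (forall i, i \in s -> v i = 0%N) ->
  is_vertex (fiber R L v) (rpoint R v).
Proof.
move=> Ls0 vs0.
apply: (is_vertex_conv_hull (c := - \row_i (i \in s)%:R)).
  by exists v => //=; rewrite subrr rpred0.
have cE u : ((- \row_i (i \in s)%:R) *m rpoint R u) 0 0 =
    - \sum_(i in s) (u i)%:R.
  rewrite mulNmx [LHS]mxE mxE [in RHS]big_mkcond /=; congr (- _).
  by apply: eq_bigr => i _; rewrite !mxE; case: ifP; rewrite ?mul1r ?mul0r.
move=> _ [u /= uL <-] uv; rewrite !cE ltrN2.
rewrite [X in X < _]big1 => [|i /vs0 -> //].
rewrite lt_def sumr_ge0 ?andbT //.
apply/negP => /eqP/psumr_eq0P us0; apply: uv; congr rpoint.
have us i : i \in s -> u i = 0%N.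
  by move=> si; apply/eqP; rewrite -(pnatr_eq0 R) us0.
have vu : zpoint v - zpoint u = 0.
  by apply: Ls0 uL _ => i si; rewrite !mxE us ?vs0.
by apply/mnmP => i; have /colP/(_ i) := subr0_eq vu; rewrite !mxE => -[].
Qed.

(** The bound keeps [v - l] and [v + l] nonnegative, so both give points of the fiber. A functional
    exposing [v] would be strictly positive on both [l] and [- l]. *)
Lemma not_vertex_fiber (R : realType) n (L : zmodClosed 'cV[int]_n)
    (l : 'cV[int]_n) (v : 'X_{1..n}) :
  l \in L -> l != 0 -> (forall i, (`|l i ord0| <= v i)%N) ->
  ~ is_vertex (fiber R L v) (rpoint R v).
Proof.
have mem_fiber u : zpoint v - zpoint u \in L -> fiber R L v (rpoint R u).
  move=> uL; exists 1, (fun=> 1), (fun=> rpoint R u).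
  by split; rewrite ?big_ord1 ?scale1r // => _; exists u.
have shift (z : 'cV[int]_n) : (forall i, (`|z i ord0| <= v i)%N) ->
    exists u : 'X_{1..n}, zpoint v - zpoint u = z.
  move=> zv; exists [multinom `|(v i)%:Z - z i ord0|%N | i < n].
  apply/colP => i; rewrite !mxE mnmE gez0_abs ?subKr //.
  by rewrite subr_ge0 (le_trans (ler_norm _)) // -abszE lez_nat.
move=> lL l0 lv [_ [c cP]].
have strict (z : 'cV[int]_n) : z \in L -> z != 0 ->
    (forall i, (`|z i ord0| <= v i)%N) ->
    0 < (c *m map_mx intr z) 0 0.
  move=> zL z0 /shift[u uz]; have uL : zpoint v - zpoint u \in L by rewrite uz.
  have uv : rpoint R u <> rpoint R v.
    move=> /colP e; case/negP: z0; rewrite -uz; apply/eqP/colP => i.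
    have := e i; rewrite !mxE => /eqP; rewrite eqr_nat => /eqP ->.
    by rewrite subrr.
  have := cP _ (mem_fiber _ uL) uv.
  by rewrite -subr_gt0 -uz -rpointB mulmxBr !mxE.
have lp := strict _ lL l0 lv.
have : 0 < (c *m map_mx intr (- l)) 0 0.
  by apply: strict => [||i]; rewrite ?rpredN ?oppr_eq0 // mxE abszN.
by rewrite map_mxN mulmxN mxE oppr_gt0 lt_gtF.
Qed.

(** * Row bases and powers of a monomial *)

Lemma multiple_not_vertex (R : realType) n m (L : zmodClosed 'cV[int]_n)
    (B : 'M[int]_(n, m)) (v : 'X_{1..n}) :
  lattice_basis L B ->
  (forall s : {set 'I_n}, #|s| = m ->
     free [seq row i (map_mx (intr : int -> rat) B) | i in s] ->
     exists2 i, i \in s & v i != 0%N) ->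
  exists e, ~ is_vertex (fiber R L (v *+ e)%MM) (rpoint R (v *+ e)%MM).
Proof.
move=> [LB B_inj] v_meets.
have [[s [sv sm frs]]|[a a0 Ba0]] :=
  kernel_or_free_rows B [set i | v i == 0%N].
  have [i si] := v_meets s sm frs.
  by have := fintype.subsetP sv i si; rewrite inE => ->.
(* This exponent bounds every coordinate of [B *m a]. On the support of [v] the multiple is at least
   that large, and off the support [B *m a] vanishes. *)
exists (\sum_i `|(B *m a) i ord0|)%N.
apply: (@not_vertex_fiber _ _ _ (B *m a)).
- by apply/LB; exists a.
- by apply: contra a0 => /eqP/B_inj ->.
move=> i; rewrite mulmnE; have [vi0|vi] := eqVneq (v i) 0%N.
  by rewrite Ba0 ?inE ?vi0.
by apply: leq_trans (leq_pmull _ _); rewrite ?lt0n // (bigD1 i) //= leq_addr.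
Qed.

Lemma basis_rows_vertex (R : realType) n m (L : zmodClosed 'cV[int]_n)
    (B : 'M[int]_(n, m)) (s : {set 'I_n}) (v : 'X_{1..n}) :
  lattice_basis L B -> #|s| = m ->
  free [seq row i (map_mx (intr : int -> rat) B) | i in s] ->
  (forall i, i \in s -> v i = 0%N) -> is_vertex (fiber R L v) (rpoint R v).
Proof.
move=> [LB _] sm frs; apply: is_vertex_fiber => _ /LB[a ->] Ba0.
(* The rows are free over the rationals, so [a] is shown to vanish there and the result is pulled
   back to the integers. *)
suff /colP aQ0 : map_mx intr a = 0 :> 'cV[rat]_m.
  have -> : a = 0; last exact: mulmx0.
  by apply/colP => j; have /eqP := aQ0 j; rewrite !mxE intr_eq0 => /eqP.
apply: free_rows_inj sm frs _ => i si.
by rewrite -map_mxM mxE Ba0.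
Qed.

Theorem theorem2p10 (R : realType) (k : fieldType) (n m : nat)
    (L : zmodClosed 'cV[int]_n) (dimL : lattice_dim L m)
    (B : 'M[int]_(n, m)) (basisB : lattice_basis L B) :
  radical (vertex_ideal R k L) =
  \bigcap_(s in [set s : {set 'I_n} | #|s| = m /\
                   free [seq row i (map_mx (intr : int -> rat) B) | i in s]])
    ideal_gen [set ('X_i : {mpoly k[n]}) | i in [set i : 'I_n | i \in s]].
Proof.
apply/seteqP; split=> f.
  (* A monomial of [f ^+ e] that avoids all variables of [s] would be a vertex of its fiber. *)
  move=> [e /vertex_ideal_span fV] s [sm frs].
  apply: var_ideal_radical; exists e.
  apply/var_idealP/restrict_vars_eq0P => v /fV nv.
  apply/exists_inP; rewrite -negb_forall_in; apply/negP => /forall_inP v0.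
  by apply: nv; apply: (basis_rows_vertex _ basisB sm frs) => i /v0/eqP.
(* The radical is closed under sums and multiples, so it is enough to treat each monomial of [f],
   whose support meets every such [s]. *)
move=> fs; rewrite (mpolyE f); apply: radical_sum => v vf.
rewrite -mul_mpolyC; apply: radicalMl.
have [|e ne] := @multiple_not_vertex R _ _ _ _ v basisB.
  by move=> s sm frs; apply: (restrict_vars_eq0P s f).1 vf;
    apply/var_idealP/fs.
by exists e; rewrite mpolyXn; apply: ideal_gen_mem; exists (v *+ e)%MM.
Qed.
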